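(* Let $p$ be a prime number and $n$ a positive integer with $n\le p$. The number $|\mathcal{F}(\mathbb{Z}_{p^n}[\alpha])|$ of polynomial functions on $\mathbb{Z}_{p^n}[\alpha]$ is given by \[ |\mathcal{F}(\mathbb{Z}_{p^n}[\alpha])|= \begin{cases} p^{(n^2+2n)p} & \text{if } n<p,\\ p^{(n^2+2n-1)p} & \text{if } n=p. \end{cases} \]
   Context: $\mathbb{Z}_m=\mathbb{Z}/m\mathbb{Z}$. For a commutative ring $R$ with $1$, the ring of dual numbers over $R$ is $R[\alpha]=R[x]/(x^2)$, where $\alpha=x+(x^2)$; so every element is uniquely $a+b\alpha$ with $a,b\in R$, and $\alpha^2=0$. For a finite commutative ring $A$, a polynomial function on $A$ is a function $A\to A$ of the form $a\mapsto f(a)$ for some $f\in A[x]$; $\mathcal{F}(A)$ denotes the set of polynomial functions on $A$. *)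

(* Defs.v *)
From HB Require Import structures.
From mathcomp Require Import all_boot all_algebra.
From mathcomp Require Import boolp.

Set Implicit Arguments.
Unset Strict Implicit.
Unset Printing Implicit Defensive.

Import GRing.Theory.
Local Open Scope ring_scope.

(* R[alpha] = R[x]/(x^2), with alpha = 'qX. As 'X^2 is monic of size > 1, the
   modulus [mk_monic 'X^2] used by [qpoly] is 'X^2 itself. *)
Definition dual (R : nzRingType) := {poly %/ ('X^2 : {poly R})}.

HB.instance Definition _ (R : comNzRingType) :=
  GRing.ComNzRing.on (dual R).
HB.instance Definition _ (R : finComNzRingType) := Finite.on (dual R).

Definition polyfun (A : finComNzRingType) : {set {ffun A -> A}} :=
  [set F | `[< exists f : {poly A}, F = [ffun a => f.[a]] >]].

(* Main.v *)
(* Write f = f1 + alpha f2 with f1, f2 over R = Z/p^n.  As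
     f(a + b alpha) = f1(a) + (b f1'(a) + f2(a)) alpha,
   the function of f amounts to the functions of f1, f1' and f2.  Expand f1 and
   f2 in powers of H = (X - 0)(X - 1)...(X - (p-1)) with digits of degree < p.
   Since p divides the values of H, a term c X^i H^k vanishes on R when
   p^k c = 0, and its derivative vanishes as well when k p^(k-1) c = 0, that is,
   when p^(k-1) c = 0 for 0 < k < p, and p^p c = 0 for k = p.  Conversely, if g
   vanishes on R, then sum_(j < n) p^j c_j Y^j, where the c_j are the Taylor
   coefficients of g at a, has degree < n <= p and the roots 0, ..., p-1, whose
   differences are units; so all p^j c_j are 0.  Applied to g and g' at
   a = 0, ..., p-1, where H has a simple zero, this bounds the digits from
   below.  Counting digits modulo these conditions gives the formula; the
   exceptional k = n = p accounts for the case distinction. *)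

From HB Require Import structures.
Require Import Defs.
From mathcomp Require Import all_boot all_algebra.
From mathcomp Require Import boolp zify ring.

Set Implicit Arguments.
Unset Strict Implicit.
Unset Printing Implicit Defensive.

Import GRing.Theory.
Local Open Scope ring_scope.

(** * Evaluation of polynomials over the dual numbers *)

Section DualNumbers.
Variable R : comNzRingType.
Implicit Types (a b : R) (g : {poly R}) (z w : dual R).

Definition to_dual : {poly R} -> dual R := in_qpoly 'X^2.

HB.instance Definition _ := GRing.RMorphism.on to_dual.

Lemma coef_to_dual g i : (i < 2)%N -> (to_dual g)`_i = g`_i.
Proof.
have monX2 : ('X^2 : {poly R}) \is monic by apply: monicXn.
move=> lt_i2; rewrite /= mk_monic_Xn /=.
rewrite {2}(Pdiv.RingMonic.rdivp_eq monX2 g) coefD coefMXn lt_i2 add0r //.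
Qed.

Lemma dual_eqP z w : reflect (z`_0 = w`_0 /\ z`_1 = w`_1) (z == w).
Proof.
apply: (iffP eqP) => [->//|[eq0 eq1]].
apply/npolyP => -[//|[//|i]]; rewrite !nth_default //.
  by apply: leq_trans (size_npoly w) _; rewrite mk_monic_Xn size_polyXn.
by apply: leq_trans (size_npoly z) _; rewrite mk_monic_Xn size_polyXn.
Qed.

Lemma to_dualK z : to_dual ((z`_0)%:P + z`_1 *: 'X) = z.
Proof.
apply/eqP/dual_eqP; rewrite !coef_to_dual // !coefD !coefZ !coefC !coefX /=.
by rewrite mulr0 mulr1 add0r addr0.
Qed.

(** The scalar ['X : {poly R}] lifts alpha. Forming the sum over [{poly R}] before applying
    [to_dual] lets values be computed as compositions in [{poly R}], through [horner_map]. *)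
Definition dual_poly (g1 g2 : {poly R}) : {poly dual R} :=
  map_poly to_dual (map_poly polyC g1 + 'X *: map_poly polyC g2).

Lemma dual_poly_surj (f : {poly dual R}) : exists g1 g2, f = dual_poly g1 g2.
Proof.
exists (\poly_(i < size f) (f`_i)`_0), (\poly_(i < size f) (f`_i)`_1).
apply/polyP => i; rewrite coef_map coefD coefZ !coef_map !coef_poly.
have [lt_i|le_i] := ltnP.
  by rewrite /= mulrC mul_polyC to_dualK.
by rewrite nth_default // !raddf0 mulr0 addr0 raddf0.
Qed.

Lemma coef0_horner_dual_poly g1 g2 z : (dual_poly g1 g2).[z]`_0 = g1.[z`_0].
Proof.
rewrite -{1}(to_dualK z) horner_map coef_to_dual //= hornerD hornerZ.
rewrite -!/(comp_poly _ _) -horner_coef0 hornerD hornerM hornerX mul0r addr0.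
by rewrite horner_comp !hornerE.
Qed.

Lemma coef1_horner_dual_poly g1 g2 z :
  (dual_poly g1 g2).[z]`_1 = g1^`().[z`_0] * z`_1 + g2.[z`_0].
Proof.
rewrite -{1}(to_dualK z) horner_map coef_to_dual //= hornerD hornerZ.
rewrite -!/(comp_poly _ _) coefD coefXM /= -!horner_coef0.
(* The linear coefficient is the value at 0 of the derivative, so the chain rule brings in the
   derivative of [g1]. *)
rewrite horner_comp -[_`_1]mulr1n -coef_deriv -horner_coef0 deriv_comp.
rewrite hornerM horner_comp derivD derivC derivZ derivX !hornerE.
by rewrite /= mulr1 horner_coef0.
Qed.

Lemma dual_polyB g1 g2 g1' g2' :
  dual_poly g1 g2 - dual_poly g1' g2' = dual_poly (g1 - g1') (g2 - g2').
Proof.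
by rewrite /dual_poly -rmorphB opprD addrACA -scalerBr !rmorphB.
Qed.

Lemma dual_poly_horner0P g1 g2 :
  (forall z, (dual_poly g1 g2).[z] = 0) <->
  (forall a, g1.[a] = 0) /\ (forall a, g1^`().[a] = 0) /\
  (forall a, g2.[a] = 0).
Proof.
split=> [null|[null1 [null1' null2]] z]; last first.
  apply/eqP/dual_eqP; rewrite coef0_horner_dual_poly coef1_horner_dual_poly.
  by rewrite null1 null1' null2 mul0r addr0 !coef0.
have null1 a b : g1.[a] = 0 /\ g1^`().[a] * b + g2.[a] = 0.
  have [z z0 z1] : exists2 z : dual R, z`_0 = a & z`_1 = b.
    exists (to_dual (a%:P + b *: 'X)).
      by rewrite coef_to_dual // coefD coefZ coefC coefX mulr0 addr0.
    by rewrite coef_to_dual // coefD coefZ coefC coefX mulr1 add0r.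
  split; first by rewrite -z0 -(coef0_horner_dual_poly g1 g2) null coef0.
  by rewrite -z0 -z1 -coef1_horner_dual_poly null coef0.
have null2 a : g2.[a] = 0 by have [_] := null1 a 0; rewrite mulr0 add0r.
split=> [a|]; first by have [] := null1 a 0.
by split=> // a; have [_] := null1 a 1; rewrite null2 addr0 mulr1.
Qed.

End DualNumbers.

(** * Taylor coefficients of null polynomials over Z/p^n *)

Section Expansions.
Variables p n : nat.
Hypotheses (p_prime : prime p) (n_gt0 : (0 < n)%N) (n_le_p : (n <= p)%N).

Local Notation R := 'Z_(p ^ n).
Local Notation pR := (p%:R : R).
Local Notation digits := {ffun 'I_n.+1 * 'I_p -> R}.
Implicit Types (g r : {poly R}) (x : R) (c d : digits)
  (u : 'I_n.+1 * 'I_p).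

Let p_gt0 : (0 < p)%N. Proof. exact: prime_gt0. Qed.

Let pn_gt1 : (1 < p ^ n)%N.
Proof. by rewrite -(exp1n n) ltn_exp2r // prime_gt1. Qed.

Lemma expr_p_eq0 j : (n <= j)%N -> pR ^+ j = 0.
Proof.
by move=> le_nj; rewrite -(subnK le_nj) exprD -!natrX pchar_Zp ?mulr0.
Qed.

Lemma natr_unit m : (0 < m < p)%N -> (m%:R : R) \is a GRing.unit.
Proof.
case/andP=> m_gt0 lt_mp; rewrite unitZpE // coprimeXl // prime_coprime //.
by rewrite gtnNdvd.
Qed.

Lemma natrB_unit a b :
  (a < p)%N -> (b < p)%N -> a != b -> (a%:R - b%:R : R) \is a GRing.unit.
Proof.
move=> lt_ap lt_bp; case: ltngtP => // lt_ab _.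
  by rewrite -opprB unitrN -natrB 1?ltnW // natr_unit //; lia.
by rewrite -natrB 1?ltnW // natr_unit //; lia.
Qed.

(** The ring may have zero divisors, so the bound on the number of roots rests on pairwise unit
    differences, as recorded by [uniq_roots]. *)
Lemma poly_eq0_of_roots g :
  (size g <= p)%N -> (forall i, (i < p)%N -> g.[i%:R] = 0) -> g = 0.
Proof.
move=> le_gp root_g; have [->//|g_neq0] := eqVneq g 0.
have root_s : all (root g) [seq i%:R | i <- iota 0 p].
  by apply/allP => _ /mapP[i i_s ->]; apply/eqP/root_g; rewrite mem_iota in i_s.
suff uniq_s : uniq_roots [seq i%:R : R | i <- iota 0 p].
  have := max_ring_poly_roots g_neq0 root_s uniq_s.
  by rewrite size_map size_iota ltnNge le_gp.
have : all (fun i => i < p)%N (iota 0 p) by apply/allP => i; rewrite mem_iota.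
have := iota_uniq 0 p; elim: (iota 0 p) => //= i s IHs /andP[i_s us].
case/andP=> lt_ip lt_sp; rewrite IHs // andbT.
apply/allP => _ /mapP[j j_s ->]; rewrite /diff_roots mulrC eqxx /=.
apply: natrB_unit => //; first exact: (allP lt_sp).
by apply: contraNneq i_s => <-.
Qed.

Definition resprod : {poly R} := \prod_(b < p) ('X - (b%:R)%:P).

Lemma monic_resprod : resprod \is monic.
Proof. exact: monic_prod_XsubC. Qed.

Lemma size_resprod : size resprod = p.+1.
Proof.
rewrite /resprod -(big_mkord xpredT (fun b => 'X - (b%:R)%:P)).
by rewrite size_prod_XsubC size_iota subn0.
Qed.

(** The factor at [b = x %% p] is [p * (x %/ p)]. *)
Lemma horner_resprod x : exists t, resprod.[x] = pR * t.
Proof.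
have lt_r : (x %% p < p)%N by rewrite ltn_mod.
exists ((x %/ p)%:R * \prod_(b < p | b != Ordinal lt_r) (x - b%:R)).
rewrite horner_prod (bigD1 (Ordinal lt_r)) //= hornerXsubC mulrA -natrM.
congr (_ * _); last by apply: eq_bigr => b _; rewrite hornerXsubC.
have {1}-> : x = (x %/ p * p + x %% p)%:R by rewrite -divn_eq natr_Zp.
by rewrite natrD addrK mulnC.
Qed.

(** Simplicity of the zero [a]: the constant coefficient of the cofactor is the product of the units
    [a - b] with [b != a]. *)
Lemma resprod_shift a : (a < p)%N ->
  exists2 w : {poly R}, w`_0 \is a GRing.unit &
                        resprod \Po ('X + (a%:R)%:P) = w * 'X.
Proof.
move=> lt_ap; pose i := Ordinal lt_ap.
exists (\prod_(b < p | b != i) ('X + (a%:R - b%:R)%:P)).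
  rewrite -horner_coef0 horner_prod unitr_prod // => b neq_bi.
  by rewrite !hornerE natrB_unit // eq_sym.
rewrite /resprod rmorph_prod (bigD1 i) //= mulrC.
rewrite comp_polyB comp_polyX comp_polyC addrK.
congr (_ * _); apply: eq_bigr => b _.
by rewrite comp_polyB comp_polyX comp_polyC polyCB addrA.
Qed.

Lemma null_coef_shift g a j : (forall x, g.[x] = 0) ->
  pR ^+ j * (g \Po ('X + a%:P))`_j = 0.
Proof.
move=> null_g; set h := g \Po _.
have [le_nj|lt_jn] := leqP n j; first by rewrite expr_p_eq0 ?mul0r.
suff /polyP/(_ j) : \poly_(i < n) (pR ^+ i * h`_i) = 0.
  by rewrite coef_poly lt_jn coef0.
apply: poly_eq0_of_roots => [|y _]; first exact: leq_trans (size_poly _ _) _.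
rewrite horner_poly /= -[RHS](null_g (pR * y%:R + a)).
rewrite -(comp_polyXaddC_K g a) -/h horner_comp !hornerE addrK.
(* The value of [h] at [p y] and the sum truncated at [n] are compared over a common range; the
   terms of index at least [n] vanish because p^n = 0. *)
rewrite (@horner_coef_wide _ (maxn n (size h))) ?leq_maxr //.
rewrite (big_ord_widen (maxn n (size h))
          (fun i => pR ^+ i * h`_i * y%:R ^+ i)) ?leq_maxl //.
rewrite big_mkcond; apply: eq_bigr => i _ /=.
case: ltnP => [_|/expr_p_eq0 p0]; first by rewrite exprMn -mulrA mulrCA.
by rewrite exprMn p0 mul0r mulr0.
Qed.

(* The p-adic valuation of k p^(k-1) when 0 < k <= p. *)
Definition deriv_val k := (k.-1 + (k == p))%N.

Lemma deriv_val_mono k l : (k <= l <= n)%N -> (deriv_val k <= deriv_val l)%N.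
Proof.
rewrite /deriv_val => /andP[le_kl le_ln].
by case: eqP; case: eqP; lia.
Qed.

(** For k > 0, coefficient k - 1 of the shifted derivative is k times coefficient k of the shifted
    [g]. As k <= p, the factor k is a unit unless k = p, where it supplies one more power of p. *)
Lemma null_deriv_coef_shift g a k :
    (forall x, g.[x] = 0) -> (forall x, g^`().[x] = 0) -> (k <= n)%N ->
  pR ^+ deriv_val k * (g \Po ('X + a%:P))`_k = 0.
Proof.
move=> null_g null_g' le_kn; case: k => [|k] in le_kn *.
  have -> : deriv_val 0 = 0%N by rewrite /deriv_val; case: eqP; lia.
  exact: null_coef_shift.
have := null_coef_shift a k null_g'.
have -> : g^`() \Po ('X + a%:P) = (g \Po ('X + a%:P))^`().
  by rewrite deriv_comp derivD derivX derivC addr0 mulr1.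
rewrite coef_deriv mulrnAr -mulr_natr /deriv_val /=.
case: eqP => [->|neq_kp]; first by rewrite addn1 exprSr mulrAC.
rewrite addn0 => null_k; have k_unit : (k.+1%:R : R) \is a GRing.unit.
  by apply: natr_unit; lia.
by apply: (mulIr k_unit); rewrite mul0r.
Qed.

Lemma resprod_expansion_coef_eq0 (s : nat -> nat) (r : nat -> {poly R}) :
    (forall k l, (k <= l <= n)%N -> (s k <= s l)%N) ->
    (forall k, (size (r k) <= p)%N) ->
    (forall a k, (k <= n)%N -> pR ^+ s k *
       ((\sum_(l < n.+1) r l * resprod ^+ l) \Po ('X + a%:P))`_k = 0) ->
  forall k, (k <= n)%N -> pR ^+ s k *: r k = 0.
Proof.
move=> s_mono size_r shift0; elim/ltn_ind => k IHk le_kn.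
apply: poly_eq0_of_roots => [|a lt_ap].
  exact: leq_trans (size_scale_leq _ _) _.
have [w w_unit Hw] := resprod_shift lt_ap.
have := shift0 a%:R k le_kn; rewrite rmorph_sum coef_sum mulr_sumr.
rewrite (bigD1 (Ordinal (le_kn : (k < n.+1)%N))) //= big1 ?addr0.
  rewrite rmorphM rmorphXn /= Hw exprMn mulrA coefMXn ltnn subnn.
  rewrite -horner_coef0 hornerM horner_comp horner_exp !hornerE /=.
  rewrite horner_coef0 => /(canRL (mulrK (unitrX k w_unit))) ->.
  by rewrite mul0r.
move=> l neq_lk; rewrite rmorphM rmorphXn /= Hw exprMn mulrA coefMXn.
have [lt_kl|le_lk] := ltnP; first by rewrite mulr0.
rewrite -coefZ scalerAl -comp_polyZ.
have lt_lk : (l < k)%N.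
  rewrite ltn_neqAle le_lk andbT.
  by apply: contraNneq neq_lk => eq_lk; apply/eqP/val_inj.
have le_s : (s l <= s k)%N by apply: s_mono; rewrite le_lk.
rewrite -(subnK le_s) exprD -scalerA IHk //; last by lia.
by rewrite scaler0 comp_poly0 mul0r coef0.
Qed.

Lemma horner_scale_resprod l r x :
  pR ^+ l *: r = 0 -> (r * resprod ^+ l).[x] = 0.
Proof.
move=> r0; have [t Ht] := horner_resprod x.
rewrite hornerM horner_exp Ht exprMn mulrA [_ * pR ^+ l]mulrC -hornerZ r0.
by rewrite horner0 mul0r.
Qed.

Lemma deriv_val_le l : (deriv_val l <= l)%N.
Proof. by rewrite /deriv_val; case: eqP; lia. Qed.

Lemma scale_deriv_val l r : pR ^+ deriv_val l *: r = 0 -> pR ^+ l *: r = 0.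
Proof.
move=> r0; rewrite -(subnK (deriv_val_le l )) exprD.
by rewrite -scalerA r0 scaler0.
Qed.

Lemma horner_deriv_scale_resprod l r x :
  pR ^+ deriv_val l *: r = 0 -> (r * resprod ^+ l)^`().[x] = 0.
Proof.
move=> r0; have [t Ht] := horner_resprod x.
rewrite derivM hornerD horner_scale_resprod ?add0r; last first.
  by rewrite -derivZ scale_deriv_val ?deriv0.
rewrite deriv_exp hornerM hornerMn hornerM horner_exp Ht exprMn.
have r0' : pR ^+ l.-1 * l%:R * r.[x] = 0.
  have := congr1 (horner^~ x) r0; rewrite /deriv_val /= hornerZ horner0.
  case: eqP => [->|_]; first by rewrite addn1 exprSr.
  by rewrite addn0 mulrAC => ->; rewrite mul0r.
transitivity (pR ^+ l.-1 * l%:R * r.[x] * (resprod^`().[x] * t ^+ l.-1)).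
  by rewrite -mulr_natr; ring.
by rewrite r0' mul0r.
Qed.

(** * Expansions in powers of [resprod] *)

Definition digit c l : {poly R} := rVpoly (\row_i c (inord l, i)).

(** The powers go up to n because the derivative of [resprod ^+ n] need not vanish on the ring when
    n < p, whereas [resprod ^+ n.+1] and its derivative always do. *)
Definition expansion c : {poly R} :=
  \sum_(l < n.+1) digit c l * resprod ^+ l.

Lemma size_digit c l : (size (digit c l) <= p)%N.
Proof. exact: size_poly. Qed.

Lemma scale_digit_eq0P e c (l : 'I_n.+1) :
  pR ^+ e *: digit c l = 0 <-> forall i, pR ^+ e * c (l, i) = 0.
Proof.
split=> [/polyP r0 i|c0].
  by have := r0 i; rewrite coefZ coef_rVpoly_ord mxE inord_val coef0.
rewrite -linearZ [_ *: _](_ : _ = 0) ?raddf0 //.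
by apply/rowP => i; rewrite !mxE inord_val c0.
Qed.

Lemma expansionB c d : expansion c - expansion d = expansion (c - d).
Proof.
rewrite -sumrB; apply: eq_bigr => l _; rewrite -mulrBl -raddfB.
by congr (rVpoly _ * _); apply/rowP => i; rewrite !mxE !ffunE.
Qed.

(** Repeated division by the monic [resprod]: the successive remainders are the digits. *)
Lemma expansion_eq g : exists c s, g = expansion c + s * resprod ^+ n.+1.
Proof.
have monH : resprod \is monic := monic_resprod.
pose quo m := iter m (fun h : {poly R} => Pdiv.Ring.rdivp h resprod) g.
have gE m : g = \sum_(l < m) Pdiv.Ring.rmodp (quo l) resprod * resprod ^+ l +
                quo m * resprod ^+ m.
  elim: m => [|m {1}->]; first by rewrite big_ord0 add0r expr0 mulr1.
  rewrite big_ord_recr -addrA; congr (_ + _) => /=.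
  rewrite {1}[quo m](Pdiv.RingMonic.rdivp_eq monH) mulrDl addrC exprS.
  by rewrite mulrA.
exists [ffun u : 'I_n.+1 * 'I_p => (Pdiv.Ring.rmodp (quo u.1) resprod)`_u.2].
exists (quo n.+1).
rewrite {1}(gE n.+1); congr (_ + _); apply: eq_bigr => l _; congr (_ * _).
have size_r : (size (Pdiv.Ring.rmodp (quo l) resprod) <= p)%N.
  by rewrite -ltnS -size_resprod Pdiv.Ring.ltn_rmodp monic_neq0.
rewrite -[LHS](poly_rV_K size_r); congr rVpoly.
by apply/rowP => i; rewrite !mxE ffunE inord_val.
Qed.

Lemma null_expansionP c :
  (forall x, (expansion c).[x] = 0) <-> forall u, pR ^+ u.1 * c u = 0.
Proof.
split=> [null_c [l i]|c0 x]; last first.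
  rewrite horner_sum big1 // => l _; apply: horner_scale_resprod.
  by apply/scale_digit_eq0P => i; apply: (c0 (l, i)).
apply: (scale_digit_eq0P l c l).1.
apply: (resprod_expansion_coef_eq0 (s := id)) (leq_ord l) => //.
- by move=> k m /andP[].
- exact: size_digit.
- by move=> a k _; apply: null_coef_shift.
Qed.

Lemma null_deriv_expansionP c :
  (forall x, (expansion c).[x] = 0) /\ (forall x, (expansion c)^`().[x] = 0) <->
  forall u, pR ^+ deriv_val u.1 * c u = 0.
Proof.
split=> [[null_c null_c'] [l i]|c0].
  apply: (scale_digit_eq0P _ c l).1.
  apply: (resprod_expansion_coef_eq0 (s := deriv_val))
    (leq_ord l).
  - by move=> k m; apply: deriv_val_mono.
  - exact: size_digit.
  - by move=> a k le_kn; apply: null_deriv_coef_shift.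
have digit0 (l : 'I_n.+1) : pR ^+ deriv_val l *: digit c l = 0.
  by apply/scale_digit_eq0P => i; apply: (c0 (l, i)).
split=> x; rewrite /expansion ?raddf_sum /= horner_sum big1 // => l _.
  exact/horner_scale_resprod/scale_deriv_val.
exact: horner_deriv_scale_resprod.
Qed.

(** Two digit systems have the same image exactly when their digits at level l agree modulo
    [p ^ (n - s l)]; congruence classes can thus be counted as an image. *)
Definition scale_digits (s : nat -> nat) c : digits :=
  [ffun u : 'I_n.+1 * 'I_p => pR ^+ s u.1 * c u].

Lemma scale_digits_eqP s c d :
  scale_digits s c = scale_digits s d <->
  forall u, pR ^+ s u.1 * (c - d) u = 0.
Proof.
split=> [/ffunP eq_cd u|eq_cd].
  by have := eq_cd u; rewrite !ffunE mulrBr => ->; rewrite subrr.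
apply/ffunP => u; apply/eqP; rewrite -subr_eq0 !ffunE -mulrBr.
by have := eq_cd u; rewrite !ffunE => ->.
Qed.

Definition digits_fun (cd : digits * digits) : {ffun dual R -> dual R} :=
  [ffun z => (dual_poly (expansion cd.1) (expansion cd.2)).[z]].

Lemma polyfun_digits : polyfun (dual R) = digits_fun @: setT.
Proof.
apply/setP => F; rewrite inE.
apply/asboolP/imsetP => [[f ->]|[cd _ ->]]; last first.
  by exists (dual_poly (expansion cd.1) (expansion cd.2)).
have [g1 [g2 ->]] := dual_poly_surj f.
have [c [s1 Eg1]] := expansion_eq g1; have [d [s2 Eg2]] := expansion_eq g2.
exists (c, d) => //; apply/ffunP => z; rewrite !ffunE /=; apply/eqP.
rewrite -subr_eq0 -hornerN -hornerD dual_polyB; apply/eqP; move: z.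
have expr_p0 e r : (n <= e)%N -> pR ^+ e *: r = 0.
  by move=> le_ne; rewrite expr_p_eq0 ?scale0r.
(* Hence the multiples of [resprod ^+ n.+1] left over by the two expansions, and their derivatives,
   are null functions. *)
have dv_n : (n <= deriv_val n.+1)%N by rewrite /deriv_val leq_addr.
rewrite Eg1 Eg2 !(addrC (expansion _)) !addrK.
by apply/dual_poly_horner0P; do !split; move=> a;
  [apply: horner_scale_resprod | apply: horner_deriv_scale_resprod
  | apply: horner_scale_resprod]; apply: expr_p0.
Qed.

Lemma digits_fun_eqP c d c' d' :
  digits_fun (c, d) = digits_fun (c', d') <->
  scale_digits deriv_val c = scale_digits deriv_val c' /\
  scale_digits id d = scale_digits id d'.
Proof.
rewrite !scale_digits_eqP -null_deriv_expansionP -null_expansionP.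
rewrite -!expansionB and_assoc -dual_poly_horner0P -dual_polyB.
split=> [/ffunP eqF z|null].
  by have := eqF z; rewrite !ffunE /= hornerD hornerN => ->; rewrite subrr.
apply/ffunP => z; apply/eqP; rewrite -subr_eq0 !ffunE /= -hornerN -hornerD.
by rewrite null.
Qed.

(** * Cardinalities *)

Lemma card_scale e :
  (e <= n)%N -> #|[set pR ^+ e * x | x : R]| = (p ^ (n - e))%N.
Proof.
move=> le_en; pose f (y : 'I_(p ^ (n - e))) : R := (p ^ e * y)%:R.
have pnE : (p ^ n = p ^ e * p ^ (n - e))%N by rewrite -expnD subnKC.
have pe_gt0 m : (0 < p ^ m)%N by rewrite expn_gt0 prime_gt0.
have f_inj : injective f.
  move=> y z /(congr1 val); rewrite /= !val_Zp_nat // !modn_small.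
  - by move/eqP; rewrite eqn_pmul2l // => /eqP/val_inj.
  - by rewrite pnE ltn_pmul2l.
  - by rewrite pnE ltn_pmul2l.
rewrite -[RHS]card_ord -(card_imset _ f_inj); apply: eq_card => y.
apply/imsetP/imsetP => -[x _ ->]; last first.
  by exists x%:R => //; rewrite /f natrM natrX.
have lt_x : (x %% p ^ (n - e) < p ^ (n - e))%N by rewrite ltn_mod.
exists (Ordinal lt_x) => //; rewrite /f /= -[in LHS](natr_Zp x).
rewrite [in LHS](divn_eq x (p ^ (n - e))) -natrX -natrM mulnDr mulnCA -pnE.
by rewrite natrD natrM pchar_Zp // mulr0 add0r.
Qed.

Lemma card_scale_digits (s : nat -> nat) :
    (forall l, (l <= n)%N -> (s l <= n)%N) ->
  #|[set scale_digits s c | c : digits]| =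
  (p ^ (\sum_(l < n.+1) (n - s l) * p))%N.
Proof.
move=> le_sn.
(* The digits are scaled independently, so the image is a product of the ideals
   [pR ^+ s u.1 * R]. *)
transitivity #|family (fun u : 'I_n.+1 * 'I_p =>
                         mem [set pR ^+ s u.1 * x | x : R])|.
  apply: eq_card => F; apply/imsetP/familyP => [[c _ ->] u|im_F].
    by rewrite ffunE; apply: imset_f.
  have ex_c u : exists x, F u == pR ^+ s u.1 * x.
    by have /imsetP[x _ ->] := im_F u; exists x.
  exists [ffun u => xchoose (ex_c u)] => //; apply/ffunP => u.
  by rewrite !ffunE; apply/eqP/(xchooseP (ex_c u)).
rewrite card_family foldrE big_map big_enum /=.
rewrite (eq_bigr (fun u => p ^ (n - s u.1))%N) => [|u _]; last first.
  by rewrite -card_scale ?le_sn // -ltnS.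
rewrite -expn_sum -(pair_big xpredT xpredT
                      (fun (l : 'I_n.+1) (_ : 'I_p) => n - s l)%N) /=.
by congr (p ^ _)%N; apply: eq_bigr => l _; rewrite sum_nat_const card_ord mulnC.
Qed.

End Expansions.

Lemma leq_card_imset (S T U : finType) (f : S -> T) (g : S -> U) :
  (forall x y, g x = g y -> f x = f y) -> (#|f @: setT| <= #|g @: setT|)%N.
Proof.
move=> fg; have [->|[x0 _]] := set_0Vmem [set: S].
  by rewrite !imset0 !cards0.
(* Factors [f] through [g] by a choice of preimage; the default [x0] is reached only outside the
   image of [g]. *)
pose h v := f (odflt x0 [pick x | g x == v]).
suff -> : f @: setT = h @: (g @: setT) by apply: leq_imset_card.
rewrite -imset_comp; apply: eq_imset => x; rewrite /= /h.
by case: pickP => [y /eqP/fg->//|/(_ x)/eqP].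
Qed.

Lemma card_imset_eq (S T U : finType) (f : S -> T) (g : S -> U) :
  (forall x y, f x = f y <-> g x = g y) -> #|f @: setT| = #|g @: setT|.
Proof.
by move=> fg; apply/eqP; rewrite eqn_leq !leq_card_imset // => x y /fg.
Qed.

(** The numbers [l.-1 + l] for l <= m add up to m^2, which stands on the left to avoid a truncated
    subtraction. *)
Lemma sum_digit_vals N m : (m <= N)%N ->
  (\sum_(l < m.+1) ((N - l.-1) + (N - l)) + m ^ 2 = 2 * N + 2 * N * m)%N.
Proof.
elim: m => [|m IHm] le_mN; first by rewrite big_ord1 /=; lia.
rewrite big_ord_recr /=; move: (IHm (ltnW le_mN)); rewrite -!mulnn.
by move: (\sum_(l < m.+1) _)%N => S; nia.
Qed.

Theorem theorem8p11 (p n : nat) (p_prime : prime p) (n_gt0 : (0 < n)%N)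
    (n_le_p : (n <= p)%N) :
  #|polyfun (dual 'Z_(p ^ n))| =
    (if (n < p)%N then p ^ ((n ^ 2 + 2 * n) * p)
     else p ^ ((n ^ 2 + 2 * n - 1) * p))%N.
Proof.
rewrite polyfun_digits //.
rewrite (card_imset_eq (g := fun cd => (scale_digits (deriv_val p) cd.1,
                                        scale_digits id cd.2))); last first.
  move=> [c d] [c' d']; rewrite digits_fun_eqP //=.
  by split=> [[-> ->]|[]].
set S := imset _ _.
pose im s := [set scale_digits s c | c : {ffun 'I_n.+1 * 'I_p -> 'Z_(p ^ n)}].
have -> : S = setX (im (deriv_val p)) (im id).
  apply/setP => -[y z]; rewrite inE /=; apply/imsetP/andP.
    by move=> [[c d] _ [-> ->]]; split; apply: imset_f.
  by case=> /imsetP[c _ ->] /imsetP[d _ ->]; exists (c, d).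
rewrite cardsX !card_scale_digits // => [|l le_ln]; last first.
  exact: leq_trans (deriv_val_le p_prime n_gt0 n_le_p l) le_ln.
rewrite -expnD -big_split /=.
under eq_bigr do rewrite -mulnDl.
rewrite -big_distrl /= {S im}.
suff -> : (\sum_(l < n.+1) (n - deriv_val p l + (n - l)) =
           if n < p then n ^ 2 + 2 * n else n ^ 2 + 2 * n - 1)%N by case: ifP.
case: n n_gt0 n_le_p => // m _ lt_mp.
(* Only the top level l = n can meet the exceptional case l = p. It contributes 1 if n < p and 0 if
   n = p; the lower levels sum to n^2 + 2n - 1. *)
rewrite big_ord_recr /=.
rewrite (eq_bigr (fun l : 'I_m.+1 => m.+1 - l.-1 + (m.+1 - l)))%N.
  have := sum_digit_vals (leqnSn m); rewrite /deriv_val -!mulnn.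
  case: (ltngtP m.+1 p) lt_mp => //= _ _;
    by move: (\sum_(l < m.+1) _)%N => S; nia.
by move=> l _; rewrite /deriv_val; case: eqP (ltn_ord l); lia.
Qed.
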